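(* Let $M$ be the complement of the $t$-axis in the upper half-space $\mathbb H^3$, with the multiplication $*$ that is the push-forward under $\widehat{Exp}:\mathbb H^3\to M$ of the additive structure on $\mathbb H^3$, i.e. $\widehat{Exp}(a_1)*\widehat{Exp}(b_1)=\widehat{Exp}(a_1+b_1)$. Then the multiplicative structure in $M$ extends to a multiplicative structure on $\mathbb H^3$.
   Context: $\mathbb H^3$ has coordinates $(x,y,t)$, $t>0$, and its additive structure is vector addition in $\mathbb R^3$. The map $\widehat{Exp}$ is an extension of $z=x+iy\mapsto e^z$ (with which it coincides when $t=0$), built as follows: the vertical half-planes $\{x=\mathrm{const}\}$ are mapped by an exponential onto the punctured unit disk, then by stereographic projection $p$ from the unit disk onto the unit hemisphere in $\mathbb H^3$, and then by a dilation $(x,y,t)\mapsto(\beta x,\beta y,\beta t)$; explicitly, $\widehat{Exp}(x,y,t)=e^x\,p(e^{-t+iy})$, that is, $$\widehat{Exp}(x,y,t)=\left(\frac{2e^{t}\cos y}{1+e^{2t}}e^{x},\ \frac{2e^{t}\sin y}{1+e^{2t}}e^{x},\ \frac{e^{2t}-1}{1+e^{2t}}e^{x}\right).$$ It is a covering of $\mathbb H^3$ onto $M$. *)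

(* Defs.v *)
From HB Require Import structures.
From mathcomp Require Import all_boot all_order all_algebra.
From mathcomp Require Import all_classical all_reals all_analysis.
From mathcomp Require Import ring lra.

Set Implicit Arguments.
Unset Strict Implicit.
Unset Printing Implicit Defensive.

Import Order.TTheory GRing.Theory Num.Theory.
Import numFieldNormedType.Exports.

Local Open Scope classical_set_scope.
Local Open Scope ring_scope.

(** A point [(x, y, t)] is [((x, y), t) : R * R * R], with the product topology
    and the componentwise addition. *)

Definition H3 (R : realType) : set (R * R * R) := [set a | 0 < a.2].
Arguments H3 : clear implicits.

Definition H3_off_axis (R : realType) : set (R * R * R) :=
  H3 R `\` [set a | a.1 = (0, 0)].
Arguments H3_off_axis : clear implicits.

Definition hatExp (R : realType) (a : R * R * R) : R * R * R :=
  let x := a.1.1 in let y := a.1.2 in let t := a.2 in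
  ( 2 * expR t * cos y / (1 + expR (2 * t)) * expR x,
    2 * expR t * sin y / (1 + expR (2 * t)) * expR x,
    (expR (2 * t) - 1) / (1 + expR (2 * t)) * expR x ).

(** [op'] is only constrained on the image [f @` D]. *)
Definition is_pushforward (T U : Type) (D : set T) (f : T -> U)
    (op : T -> T -> T) (op' : U -> U -> U) : Prop :=
  forall a b, D a -> D b -> op' (f a) (f b) = f (op a b).

(** Operations on a subset [D] of a space are total functions on the space, of
    which only the values on [D] matter.  No unit is required: addition on [H3]
    has none. *)
Definition multiplicative_structure (T : topologicalType) (D : set T)
    (mul : T -> T -> T) : Prop :=
  [/\ forall p q, D p -> D q -> D (mul p q),
      forall p q r, D p -> D q -> D r -> mul p (mul q r) = mul (mul p q) r,
      forall p q, D p -> D q -> mul p q = mul q p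
    & {within D `*` D, continuous (fun pq : T * T => mul pq.1 pq.2)}].

Section hatExp_facts.
Variable R : realType.
Implicit Types (a b p : R * R * R) (c s : R).

Lemma hatExp_eq a b : hatExp a = hatExp b ->
  [/\ a.1.1 = b.1.1, a.2 = b.2, cos a.1.2 = cos b.1.2 & sin a.1.2 = sin b.1.2].
Proof.
case: a b => [[x y] t] [[x' y'] t'] /=; rewrite /hatExp /= !expRM_natl.
have := expR_gt0 x; have := expR_gt0 x'; have := expR_gt0 t; have := expR_gt0 t'.
have := cos2Dsin2 y; have := cos2Dsin2 y'.
move: (@expR_inj R x x') (@expR_inj R t t').
move: (expR x) (expR x') (expR t) (expR t') (cos y) (cos y') (sin y) (sin y').
move=> E E' T T' c c' s s' injE injT n' n T'0 T0 E'0 E0 [e1 e2 e3].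
have D0 : 0 < 1 + T ^+ 2 by rewrite ltr_wpDr ?sqr_ge0.
have D'0 : 0 < 1 + T' ^+ 2 by rewrite ltr_wpDr ?sqr_ge0.
have sq (F W k l : R) : 0 < 1 + W ^+ 2 -> k ^+ 2 + l ^+ 2 = 1 ->
    (2 * W * k / (1 + W ^+ 2) * F) ^+ 2 + (2 * W * l / (1 + W ^+ 2) * F) ^+ 2 +
    ((W ^+ 2 - 1) / (1 + W ^+ 2) * F) ^+ 2 = F ^+ 2.
  move=> W0 kl.
  transitivity
    (F ^+ 2 * (4 * W ^+ 2 * (k ^+ 2 + l ^+ 2) + (W ^+ 2 - 1) ^+ 2)
       / (1 + W ^+ 2) ^+ 2); first by field; rewrite gt_eqF.
  by rewrite kl; field; rewrite gt_eqF.
have EE : E = E'.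
  apply/eqP; rewrite -(@eqrXn2 _ 2) ?ltW //; apply/eqP.
  by rewrite -(sq E T c s) // -(sq E' T' c' s') // e1 e2 e3.
subst E'; move/(mulIf (lt0r_neq0 E0)): e3 => e3.
have TT : T = T'.
  apply/eqP; rewrite -(@eqrXn2 _ 2) ?ltW //; apply/eqP.
  have D2 (W : R) : 0 < 1 + W ^+ 2 -> (W ^+ 2 - 1) / (1 + W ^+ 2) = 1 - 2 / (1 + W ^+ 2).
    by move=> W0; field; rewrite gt_eqF.
  move: e3; rewrite !D2 // => /addrI/oppr_inj/(mulfI (lt0r_neq0 (@ltr0Sn R 1))).
  by move/invr_inj/addrI.
subst T'.
have k0 : 2 * T / (1 + T ^+ 2) * E != 0.
  by rewrite gt_eqF // mulr_gt0 // divr_gt0 // mulr_gt0.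
split; [exact: injE | exact: injT | |]; apply: (mulfI k0).
- by move: e1; rewrite !(mulrAC _ _ E) !(mulrAC _ _ (1 + _)^-1).
- by move: e2; rewrite !(mulrAC _ _ E) !(mulrAC _ _ (1 + _)^-1).
Qed.

Lemma hatExpD_eq a a' b b' : hatExp a = hatExp a' -> hatExp b = hatExp b' ->
  hatExp (a + b) = hatExp (a' + b').
Proof.
case: a a' b b' => [[x y] t] [[x' y'] t'] [[u v] w] [[u' v'] w'].
move=> /hatExp_eq /= [-> -> cy sy] /hatExp_eq /= [-> -> cv sv].
by rewrite /hatExp /= !cosD !sinD cy sy cv sv.
Qed.

Lemma polar_angle c s : c ^+ 2 + s ^+ 2 = 1 -> exists y, cos y = c /\ sin y = s.
Proof.
move=> cs1; have c1 : -1 <= c <= 1 by apply/andP; split; nra.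
have [s0|s0] := leP 0 s.
  exists (acos c); rewrite acosK ?in_itv //= sin_acos //; split=> //.
  by rewrite -cs1 addrC addKr sqrtr_sqr ger0_norm.
exists (- acos c); rewrite cosN sinN acosK ?in_itv //= sin_acos //; split=> //.
by rewrite -cs1 addrC addKr sqrtr_sqr ltr0_norm // opprK.
Qed.

Lemma image_hatExp : @hatExp R @` H3 R = H3_off_axis R.
Proof.
apply/seteqP; split=> [_ [[[x y] t] /= t0 <-]|[[u v] w] [/= w0 uv0]].
  have D0 : 0 < 1 + expR (2 * t) by rewrite ltr_wpDr ?expR_ge0.
  split; rewrite /H3 /hatExp /=.
    by rewrite mulr_gt0 ?expR_gt0 // divr_gt0 // subr_gt0 expR_gt1 mulr_gt0.
  have n0 k : 2 * expR t * k / (1 + expR (2 * t)) * expR x = 0 -> k = 0.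
    move/eqP; rewrite !mulf_eq0 invr_eq0 (gt_eqF D0).
    by rewrite !(gt_eqF (expR_gt0 _)) pnatr_eq0 !orbF => /eqP.
  move=> [/n0 c0 /n0 s0]; have := cos2Dsin2 y.
  by rewrite c0 s0 expr0n addr0 => /eqP; rewrite eq_sym oner_eq0.
have r0 : 0 < u ^+ 2 + v ^+ 2.
  rewrite lt_neqAle addr_ge0 ?sqr_ge0 // andbT eq_sym.
  rewrite paddr_eq0 ?sqr_ge0 // !sqrf_eq0.
  by apply/negP => /andP[/eqP u0 /eqP v0]; apply: uv0; rewrite u0 v0.
pose N := Num.sqrt (u ^+ 2 + v ^+ 2 + w ^+ 2).
pose r := Num.sqrt (u ^+ 2 + v ^+ 2).
have N2 : N ^+ 2 = r ^+ 2 + w ^+ 2.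
  by rewrite !sqr_sqrtr ?addr_ge0 ?sqr_ge0 // ltW.
have rp : 0 < r by rewrite sqrtr_gt0.
have Np : 0 < N by rewrite sqrtr_gt0 ltr_wpDr ?sqr_ge0.
have r2 : r ^+ 2 = u ^+ 2 + v ^+ 2 by rewrite sqr_sqrtr // ltW.
have [y [cy sy]] : exists y, cos y = u / r /\ sin y = v / r.
  apply: polar_angle; rewrite !exprMn -mulrDl -r2 -exprMn divff ?gt_eqF //.
  by rewrite expr1n.
(* tanh t = w / N and sech t = r / N, hence expR t = (N + w) / r *)
have rN : r <= N by rewrite ler_wsqrtr // lerDl sqr_ge0.
have T1 : 1 < (N + w) / r by rewrite ltr_pdivlMr // mul1r (le_lt_trans rN) // ltrDl.
have T0 : 0 < (N + w) / r := lt_trans ltr01 T1.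
exists (ln N, y, ln ((N + w) / r)); first by rewrite /H3 /= ln_gt0.
have Nw : N + w != 0 by rewrite gt_eqF // addr_gt0.
have rn : r != 0 by rewrite gt_eqF.
have Nn : N != 0 by rewrite gt_eqF.
have D : 1 + ((N + w) / r) ^+ 2 = 2 * N * (N + w) / r ^+ 2.
  have -> : 2 * N * (N + w) = r ^+ 2 + (N + w) ^+ 2.
    have -> : r ^+ 2 = N ^+ 2 - w ^+ 2 by rewrite N2 addrK.
    by ring.
  by field.
have D' : ((N + w) / r) ^+ 2 - 1 = 2 * w * (N + w) / r ^+ 2.
  have -> : 2 * w * (N + w) = (N + w) ^+ 2 - r ^+ 2.
    have -> : r ^+ 2 = N ^+ 2 - w ^+ 2 by rewrite N2 addrK.
    by ring.
  by field.
rewrite /hatExp /= expRM_natl !lnK ?posrE // cy sy D D'.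
by congr (_, _, _); field; rewrite ?Nn ?Nw ?rn.
Qed.

Lemma hatExp_pushforward_exists : exists mulM : R * R * R -> R * R * R -> R * R * R,
  is_pushforward (H3 R) (@hatExp R) +%R mulM.
Proof.
pose log p := get [set a | hatExp a = p].
exists (fun p q => hatExp (log p + log q)) => a b _ _.
by apply: hatExpD_eq; apply: (@getPex _ [set c | hatExp c = _]);
  [exists a | exists b].
Qed.

End hatExp_facts.

(* Main.v *)
(** In the coordinates [z = u + iv], [w] of the upper half-space and with
    [N = |(z, w)|], the map [hatExp] satisfies [N = e^x], [w / N = tanh t] and
    [z / N = e^(iy) / cosh t].  The addition formulas for [tanh] and [1 / cosh]
    turn addition of exponents into
      [z = z1 z2 N1 N2 / (N1 N2 + w1 w2)],
      [w = N1 N2 (w1 N2 + w2 N1) / (N1 N2 + w1 w2)],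
    in which the argument of [z] no longer occurs: as [N1 N2 + w1 w2 > 0] on the
    whole half-space, the same formula defines the product on the axis [z = 0].
    Associativity is a rational identity once [N] is known to be multiplicative. *)
Require Import Defs.
From mathcomp Require Import all_boot all_order all_algebra.
From mathcomp Require Import all_classical all_reals all_analysis.
From mathcomp Require Import ring.

Import Order.TTheory GRing.Theory Num.Theory.
Import numFieldNormedType.Exports.

Local Open Scope classical_set_scope.
Local Open Scope ring_scope.

Definition norm3 {R : realType} (p : R * R * R) : R :=
  Num.sqrt (p.1.1 ^+ 2 + p.1.2 ^+ 2 + p.2 ^+ 2).

(** The first two components are the complex product of the horizontal parts, scaled by [k]. Where
    the denominator vanishes, outside the half-space, [k] is 0. *)
Definition mulH {R : realType} (p q : R * R * R) : R * R * R :=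
  let N := norm3 p * norm3 q in
  let k := N / (N + p.2 * q.2) in
  ( (p.1.1 * q.1.1 - p.1.2 * q.1.2) * k,
    (p.1.1 * q.1.2 + p.1.2 * q.1.1) * k,
    (p.2 * norm3 q + q.2 * norm3 p) * k ).

Section extended_product.
Variable R : realType.
Implicit Types (a b p q s : R * R * R).

Lemma sqr_norm3 p : norm3 p ^+ 2 = p.1.1 ^+ 2 + p.1.2 ^+ 2 + p.2 ^+ 2.
Proof. by rewrite sqr_sqrtr // !addr_ge0 ?sqr_ge0. Qed.

Lemma norm3_unique p (c : R) : 0 <= c ->
  p.1.1 ^+ 2 + p.1.2 ^+ 2 + p.2 ^+ 2 = c ^+ 2 -> norm3 p = c.
Proof. by move=> c0 e; rewrite /norm3 e sqrtr_sqr ger0_norm. Qed.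

Lemma norm3_gt0 p : H3 R p -> 0 < norm3 p.
Proof.
by move=> p0; rewrite sqrtr_gt0 ltr_wpDl ?addr_ge0 ?sqr_ge0 // exprn_gt0.
Qed.

Lemma mulH_den_gt0 p q : H3 R p -> H3 R q ->
  0 < norm3 p * norm3 q + p.2 * q.2.
Proof. by move=> p0 q0; rewrite addr_gt0 // mulr_gt0 // norm3_gt0. Qed.

Lemma mulH_H3 p q : H3 R p -> H3 R q -> H3 R (mulH p q).
Proof.
move=> p0 q0; rewrite /H3 /=.
have Np := norm3_gt0 _ p0; have Nq := norm3_gt0 _ q0.
by rewrite mulr_gt0 ?divr_gt0 ?mulH_den_gt0 ?addr_gt0 ?mulr_gt0.
Qed.

(** Complex moduli multiply, and |z|^2 = N^2 - w^2 turns the claim into (M^2 - w^2)(N^2 - w'^2) + (w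
    N + w' M)^2 = (M N + w w')^2. *)
Lemma norm3_mulH p q : H3 R p -> H3 R q ->
  norm3 (mulH p q) = norm3 p * norm3 q.
Proof.
move=> p0 q0; have Np := norm3_gt0 _ p0; have Nq := norm3_gt0 _ q0.
have D0 := mulH_den_gt0 _ _ p0 q0.
apply: norm3_unique; first by rewrite mulr_ge0 ?ltW.
have := sqr_norm3 p; have := sqr_norm3 q; rewrite /mulH /=.
move: (norm3 p) (norm3 q) D0 => M N D0 eN eM.
have zM : p.1.1 ^+ 2 + p.1.2 ^+ 2 = M ^+ 2 - p.2 ^+ 2 by rewrite eM addrK.
have zN : q.1.1 ^+ 2 + q.1.2 ^+ 2 = N ^+ 2 - q.2 ^+ 2 by rewrite eN addrK.
transitivity (((p.1.1 ^+ 2 + p.1.2 ^+ 2) * (q.1.1 ^+ 2 + q.1.2 ^+ 2) +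
  (p.2 * N + q.2 * M) ^+ 2) * (M * N / (M * N + p.2 * q.2)) ^+ 2); first by ring.
by rewrite zM zN; field; rewrite gt_eqF.
Qed.

Lemma mulHC p q : mulH p q = mulH q p.
Proof.
rewrite /mulH (mulrC (norm3 q) (norm3 p)) (mulrC q.2 p.2).
by congr (_ * _, _ * _, _ * _); ring.
Qed.

Lemma mulHA p q s : H3 R p -> H3 R q -> H3 R s ->
  mulH p (mulH q s) = mulH (mulH p q) s.
Proof.
move=> p0 q0 s0; have Np := norm3_gt0 _ p0; have Nq := norm3_gt0 _ q0.
have Ns := norm3_gt0 _ s0.
(* Only the outer products are unfolded, so that the inner ones still stand under [norm3]. *)
rewrite {1}/mulH [RHS]/mulH !norm3_mulH //.
rewrite /mulH /=; rewrite /H3 /= in p0 q0 s0.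
(* The norms become independent positive variables; all denominators are built from positive
   terms. *)
move: (norm3 p) (norm3 q) (norm3 s) p0 q0 s0 Np Nq Ns.
case: p q s => [[u v] w] [[u' v'] w'] [[u'' v''] w''] /= L M N w0 w'0 w''0.
move=> L0 M0 N0.
by congr (_, _, _); field; rewrite !gt_eqF //;
  do ?[apply: addr_gt0 | apply: mulr_gt0].
Qed.

(** Stereographic projection lands on the unit sphere, by 4 T^2 + (T^2 - 1)^2 = (1 + T^2)^2 with T =
    e^t, and the dilation scales by e^x. *)
Lemma norm3_hatExp a : norm3 (hatExp a) = expR a.1.1.
Proof.
apply: norm3_unique; first exact: expR_ge0.
rewrite /hatExp /= expRM_natl.
have D0 : 0 < 1 + expR a.2 ^+ 2 by rewrite ltr_wpDr ?sqr_ge0.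
have cs := cos2Dsin2 a.1.2.
move: (expR a.1.1) (expR a.2) (cos _) (sin _) cs D0 => E T c s cs D0.
transitivity (E ^+ 2 * (4 * T ^+ 2 * (c ^+ 2 + s ^+ 2) + (T ^+ 2 - 1) ^+ 2)
  / (1 + T ^+ 2) ^+ 2); first by field; rewrite gt_eqF.
by rewrite cs; field; rewrite gt_eqF.
Qed.

Lemma mulH_hatExp a b : mulH (hatExp a) (hatExp b) = hatExp (a + b).
Proof.
rewrite /mulH !norm3_hatExp /hatExp /= !mulrDr !expRD !expRM_natl.
rewrite cosD sinD.
have E0 := expR_gt0 a.1.1; have F0 := expR_gt0 b.1.1.
have S0 := expR_gt0 a.2; have T0 := expR_gt0 b.2.
move: (expR a.1.1) (expR b.1.1) (expR a.2) (expR b.2) E0 F0 S0 T0.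
move=> E F S T E0 F0 S0 T0.
have DS : 0 < 1 + S ^+ 2 by rewrite ltr_wpDr ?sqr_ge0.
have DT : 0 < 1 + T ^+ 2 by rewrite ltr_wpDr ?sqr_ge0.
have DST : 0 < 1 + (S * T) ^+ 2 by rewrite ltr_wpDr ?sqr_ge0.
(* With S = e^s and T = e^t, the factor [k] is 1 / (1 + tanh s tanh t) = cosh s cosh t / cosh(s +
   t). *)
have -> : E * F / (E * F + (S ^+ 2 - 1) / (1 + S ^+ 2) * E *
    ((T ^+ 2 - 1) / (1 + T ^+ 2) * F)) =
    (1 + S ^+ 2) * (1 + T ^+ 2) / (2 * (1 + S ^+ 2 * T ^+ 2)).
  have -> : E * F + (S ^+ 2 - 1) / (1 + S ^+ 2) * E *
      ((T ^+ 2 - 1) / (1 + T ^+ 2) * F) =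
      E * F * (2 * (1 + S ^+ 2 * T ^+ 2)) / ((1 + S ^+ 2) * (1 + T ^+ 2)).
    by field; rewrite !gt_eqF.
  by field; rewrite !gt_eqF.
by congr (_, _, _); field; rewrite !gt_eqF.
Qed.

Lemma cvg_coords (T : Type) (F : set_system T) (FF : Filter F)
    (g : T -> R * R * R) (l : R * R * R) : g @ F --> l ->
  [/\ (fun t => (g t).1.1) @ F --> l.1.1, (fun t => (g t).1.2) @ F --> l.1.2
    & (fun t => (g t).2) @ F --> l.2].
Proof.
move=> gl; have gl1 : (fun t => (g t).1) @ F --> l.1.
  by apply: (cvg_comp _ _ gl); exact: cvg_fst.
split; [apply: (cvg_comp _ _ gl1) | apply: (cvg_comp _ _ gl1) |
  apply: (cvg_comp _ _ gl)]; [exact: cvg_fst | exact: cvg_snd | exact: cvg_snd].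
Qed.

Lemma norm3_continuous : continuous (@norm3 R).
Proof.
move=> p; apply: (@continuous_comp _ _ _
  (fun p : R * R * R => p.1.1 ^+ 2 + p.1.2 ^+ 2 + p.2 ^+ 2) Num.sqrt).
  have [u v w] := cvg_coords _ _ _ id p (@cvg_id _ (nbhs p)).
  exact: cvgD (cvgD (cvgM u u) (cvgM v v)) (cvgM w w).
exact: sqrt_continuous.
Qed.

Lemma mulH_continuous_at (pq : (R * R * R) * (R * R * R)) :
  (H3 R `*` H3 R) pq ->
  {for pq, continuous (fun pq => mulH pq.1 pq.2)}.
Proof.
case: pq => p q [/= p0 q0]; have D0 := mulH_den_gt0 _ _ p0 q0.
rewrite /prop_for /continuous_at /mulH /=.
have c1 : fst @ (p, q) --> p by exact: cvg_fst.
have c2 : snd @ (p, q) --> q by exact: cvg_snd.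
have cN1 := cvg_comp _ _ c1 (norm3_continuous p).
have cN2 := cvg_comp _ _ c2 (norm3_continuous q).
have [u1 v1 w1] := cvg_coords _ _ _ _ _ c1.
have [u2 v2 w2] := cvg_coords _ _ _ _ _ c2.
pose N (pq : (R * R * R) * (R * R * R)) := norm3 pq.1 * norm3 pq.2.
have cN : N x @[x --> (p, q)] --> N (p, q) by exact: cvgM cN1 cN2.
have ck : N x / (N x + x.1.2 * x.2.2) @[x --> (p, q)] -->
    N (p, q) / (N (p, q) + p.2 * q.2).
  (* Positivity of the denominator, on the axis as well as off it, makes the quotient continuous. *)
  exact: cvgM cN (cvgV (lt0r_neq0 D0) (cvgD cN (cvgM w1 w2))).
exact: cvg_pair
  (cvg_pair (cvgM (cvgB (cvgM u1 u2) (cvgM v1 v2)) ck)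
    (cvgM (cvgD (cvgM u1 v2) (cvgM v1 u2)) ck))
  (cvgM (cvgD (cvgM w1 cN2) (cvgM w2 cN1)) ck).
Qed.

Lemma mulH_structure : multiplicative_structure (H3 R) mulH.
Proof.
split; [exact: mulH_H3 | exact: mulHA | by move=> *; exact: mulHC |].
by apply: continuous_in_subspaceT => pq /set_mem; exact: mulH_continuous_at.
Qed.

End extended_product.

Theorem lemma20 (R : realType) (mulM : R * R * R -> R * R * R -> R * R * R)
    (hmulM : is_pushforward (H3 R) (@hatExp R) +%R mulM) :
  exists mul : R * R * R -> R * R * R -> R * R * R,
    multiplicative_structure (H3 R) mul /\
    (forall p q, H3_off_axis R p -> H3_off_axis R q -> mul p q = mulM p q).
Proof.
exists mulH; split; first exact: mulH_structure.
(* Points off the axis are values of [hatExp], where [hmulM] determines [mulM]. *)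
move=> p q; rewrite -image_hatExp => -[a a0 <-] [b b0 <-].
by rewrite hmulM // mulH_hatExp.
Qed.
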